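(* Let $A, B$ be $n\times n$ positive semidefinite complex matrices and let $X$ be any $n\times n$ complex matrix. Let $s,t$ be real numbers with $0\le s<\tfrac12$ and $|1-2t|<\tfrac{1-2s}{2}$. Then for every unitarily invariant norm $|||\cdot|||$ on $n\times n$ complex matrices, $$|||A^{1-t}XB^t+A^tXB^{1-t}|||\le \frac{2}{1-2s}\,\Big|\Big|\Big|\int_s^{1-s}A^vXB^{1-v}\,dv\Big|\Big|\Big|.$$
   Context: A norm $|||\cdot|||$ on $n\times n$ complex matrices is unitarily invariant if $|||UXV|||=|||X|||$ for all matrices $X$ and all unitary $U,V$. Real powers of positive semidefinite matrices are defined by the spectral functional calculus, with the convention $A^0=I$. The integral is the entrywise (Riemann/Lebesgue) integral of a matrix-valued function. *)

(* Defs.v *)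
From HB Require Import structures.
From mathcomp Require Import all_boot all_order all_algebra.
From mathcomp Require Import complex.
From mathcomp Require Import all_classical all_reals all_analysis.

Set Implicit Arguments.
Unset Strict Implicit.
Unset Printing Implicit Defensive.

Import Order.TTheory GRing.Theory Num.Theory.
Import numFieldNormedType.Exports.

Local Open Scope ring_scope.
Local Open Scope classical_set_scope.
Local Open Scope complex_scope.
Local Open Scope sesquilinear_scope.

(* The order on R[i] makes [0 <= z] mean that z is real and nonnegative. *)
Definition psdmx (R : realType) (n : nat) (A : 'M[R[i]]_n) : Prop :=
  A \is hermsymmx /\
  forall x : 'cV[R[i]]_n, 0 <= (x ^t* *m A *m x) 0 0.

(* For a normal matrix, A = invmx P *m diag_mx d *m P with P := spectralmx A
   unitary and d := spectral_diag A.  A hermitian matrix has real eigenvalues,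
   so taking the real part of d loses nothing; powR satisfies 0 `^ 0 = 1 and
   0 `^ r = 0 for r != 0, hence mxpowR A 0 = 1%:M. *)
Definition mxpowR (R : realType) (n : nat) (A : 'M[R[i]]_n) (r : R) :
    'M[R[i]]_n :=
  invmx (spectralmx A)
  *m diag_mx (map_mx (fun z : R[i] => (complex.Re z `^ r)%:C) (spectral_diag A))
  *m spectralmx A.

Definition mxintegral (R : realType) (m n : nat) (D : set R)
    (F : R -> 'M[R[i]]_(m, n)) : 'M[R[i]]_(m, n) :=
  \matrix_(i, j)
    ((\int[@lebesgue_measure R]_(v in D) complex.Re (F v i j))
     +i* (\int[@lebesgue_measure R]_(v in D) complex.Im (F v i j))).

Record unitarily_invariant_norm (R : realType) (n : nat)
    (N : 'M[R[i]]_n -> R) : Prop := UnitarilyInvariantNorm {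
  uinormD : forall X Y, N (X + Y) <= N X + N Y;
  uinormZ : forall (a : R[i]) X, N (a *: X) = complex.Re `|a| * N X;
  uinorm_eq0 : forall X, N X = 0 -> X = 0;
  uinormU : forall U V X, U \is unitarymx -> V \is unitarymx ->
    N (U *m X *m V) = N X
}.

(* Main.v *)
Require Import Defs.
From mathcomp Require Import all_boot all_order all_algebra.
From mathcomp Require Import complex.
From mathcomp Require Import all_classical all_reals all_analysis.
From mathcomp Require Import measurable_realfun.
From mathcomp Require Import ring lra.

(* In the eigenbases of A and B, both sides are Schur multiples of Y = P X Q^-1.
   With d = ln lambda_i - ln mu_j, al = 1/2 - s, be = |1/2 - t| and
   S(x) = sinh x / x, the left-hand entry is that of the integral times
   cosh(be d) / (al S(al d)) = S(2 be d) / (al S(be d) S(al d)).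
   It therefore suffices that N(S(u d) Z) is nondecreasing in u >= 0, applied
   to 0 <= be and to 2 be <= al.  Now S(x) is the limit of
   ((1 + x/n)^n - (1 - x/n)^n) / (2x), a polynomial with purely imaginary roots,
   i.e. a product of factors 1 + icx.  Hence only
   N((1 + igd) Z) <= N((1 + id) Z) for 0 <= g <= 1 is needed; it holds by
   convexity, because 1 + ihd is to first order in h a two-sided multiplication
   by unitary diagonal matrices.
   Zero eigenvalues contribute nothing to either side, as t lies in (0, 1). *)

Set Implicit Arguments.
Unset Strict Implicit.
Unset Printing Implicit Defensive.

Import Order.TTheory GRing.Theory Num.Theory.
Import numFieldNormedType.Exports.

Local Open Scope ring_scope.
Local Open Scope classical_set_scope.
Local Open Scope complex_scope.

Local Notation normc := ComplexField.Normc.normc.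

(** * Moduli of complex numbers *)

Section Complex.
Context {R : realType}.
Implicit Types (z : R[i]) (x y : R).

Lemma normcM z w : normc (z * w) = normc z * normc w.
Proof. exact: ComplexField.Normc.normcM. Qed.

Lemma normcV z : normc z^-1 = (normc z)^-1.
Proof. exact: ComplexField.Normc.normcV. Qed.

Lemma normc_ge0 z : 0 <= normc z.
Proof. by case: z => x y; exact: sqrtr_ge0. Qed.

Lemma normc_real x : normc x%:C = `|x|.
Proof. by rewrite /normc /= expr0n addr0 sqrtr_sqr. Qed.

Lemma normc_imag x : normc (0 +i* x) = `|x|.
Proof. by rewrite /normc /= expr0n add0r sqrtr_sqr. Qed.

Lemma ler_normc_Re x y : `|x| <= normc (x +i* y).
Proof. by rewrite /normc /= -sqrtr_sqr ler_wsqrtr// lerDl sqr_ge0. Qed.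

Lemma normc_le_add x y : normc (x +i* y) <= `|x| + `|y|.
Proof.
have -> : x +i* y = x%:C + (0 +i* y) :> R[i] by simpc.
by apply: le_trans (le_normcD _ _) _; rewrite normc_real normc_imag.
Qed.

End Complex.

(** * Schur multipliers and continuity of unitarily invariant norms *)

Section SchurMultiplier.
Context {R : realType} {n : nat}.
Implicit Types (f g : 'I_n -> 'I_n -> R[i]) (Z : 'M[R[i]]_n).

Definition schur f Z : 'M[R[i]]_n := \matrix_(i, j) (f i j * Z i j).

Lemma eq_schur f g Z : (forall i j, f i j = g i j) -> schur f Z = schur g Z.
Proof. by move=> fg; apply/matrixP => i j; rewrite !mxE fg. Qed.

Lemma schurA f g Z : schur f (schur g Z) = schur (fun i j => f i j * g i j) Z.
Proof. by apply/matrixP => i j; rewrite !mxE mulrA. Qed.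

Lemma schurC f g Z : schur f (schur g Z) = schur g (schur f Z).
Proof. by apply/matrixP => i j; rewrite !mxE mulrCA. Qed.

Lemma schur1 f Z : (forall i j, f i j = 1) -> schur f Z = Z.
Proof. by move=> f1; apply/matrixP => i j; rewrite !mxE f1 mul1r. Qed.

Context (N : 'M[R[i]]_n -> R) (hN : unitarily_invariant_norm N).

Lemma uinorm_scale a Z : N (a *: Z) = normc a * N Z.
Proof. exact: (uinormZ hN). Qed.

Lemma uinorm_realZ (c : R) Z : 0 <= c -> N (c%:C *: Z) = c * N Z.
Proof. by move=> c0; rewrite uinorm_scale normc_real ger0_norm. Qed.

Lemma uinorm0 : N 0 = 0.
Proof.
by rewrite -(scale0r 0) uinorm_scale ComplexField.Normc.normc0 mul0r.
Qed.

Lemma uinormN Z : N (- Z) = N Z.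
Proof.
by rewrite -scaleN1r uinorm_scale normcN ComplexField.Normc.normc1 mul1r.
Qed.

Lemma uinorm_ge0 Z : 0 <= N Z.
Proof.
by have := uinormD hN Z (- Z); rewrite subrr uinorm0 uinormN; lra.
Qed.

Lemma uinorm_sum (I : Type) (r : seq I) (F : I -> 'M[R[i]]_n) :
  N (\sum_(i <- r) F i) <= \sum_(i <- r) N (F i).
Proof.
elim/big_ind2 : _ => [|X a Y b Xa Yb|//]; first by rewrite uinorm0.
by apply: le_trans (uinormD hN _ _) _; rewrite lerD.
Qed.

(** Expansion in matrix units; it yields the continuity of [N] behind the limits and the first-order
    estimates below. *)
Lemma uinorm_le_entries Z :
  N Z <= \sum_i \sum_j normc (Z i j) * N (delta_mx i j).
Proof.
rewrite {1}(matrix_sum_delta Z).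
apply: le_trans (uinorm_sum _ _) _; apply: ler_sum => i _.
apply: le_trans (uinorm_sum _ _) _; apply: ler_sum => j _.
by rewrite uinorm_scale.
Qed.

Lemma uinorm_distr X Y : `|N X - N Y| <= N (X - Y).
Proof.
have h1 := uinormD hN (X - Y) Y; have h2 := uinormD hN (Y - X) X.
move: h1 h2; rewrite !subrK -(opprB X) uinormN => h1 h2.
rewrite ler_norml; lra.
Qed.

(** [N] is Lipschitz in the entries, so entrywise convergence of the multipliers suffices. This
    carries inequalities from polynomial multipliers to their limits. *)
Lemma uinorm_schur_cvg (f : nat -> 'I_n -> 'I_n -> R)
    (g : 'I_n -> 'I_n -> R) Z :
  (forall i j, f ^~ i ^~ j @ \oo --> g i j) ->
  N (schur (fun i j => (f k i j)%:C) Z) @[k --> \oo]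
    --> N (schur (fun i j => (g i j)%:C) Z).
Proof.
move=> fg.
pose B (k : nat) :=
  \sum_i \sum_j `|f k i j - g i j| * (normc (Z i j) * N (delta_mx i j)).
have B0 : B k @[k --> \oo] --> (0 : R).
  have -> : 0 = \sum_(i < n) \sum_(j < n) (0 : R).
    by rewrite big1// => i _; rewrite big1.
  apply: cvg_big => [|i _]; first exact: add_continuous.
  apply: cvg_big => [|j _]; first exact: add_continuous.
  rewrite -(mul0r (normc (Z i j) * N (delta_mx i j))).
  apply: cvgMl; rewrite -(normr0 R); apply: cvg_norm.
  by rewrite -(subrr (g i j)); apply: cvgB => //; exact: cvg_cst.
have le_B k : `|N (schur (fun i j => (f k i j)%:C) Z) -
     N (schur (fun i j => (g i j)%:C) Z)| <= B k.
  apply: le_trans (uinorm_distr _ _) _.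
  apply: le_trans (uinorm_le_entries _) _.
  apply: ler_sum => i _; apply: ler_sum => j _.
  by rewrite !mxE -mulrBl -rmorphB normcM normc_real mulrA.
apply/subr_cvg0/norm_cvg0P.
apply: (squeeze_cvgr _ _ B0); last exact: cvg_cst.
by near=> k; rewrite normr_ge0 le_B.
Unshelve. all: by end_near.
Qed.

(* The Cayley transform [w / w^*], [w = 1 + iha], of the diagonal matrix [ha] is
   unitary and agrees with [1 + 2iha] to first order. *)
Lemma uinorm_cayley (a b : 'I_n -> R) (h : R) Z :
  N (schur (fun i j => (1 +i* (h * a i)) * (1 -i* (h * b j)) /
                       ((1 -i* (h * a i)) * (1 +i* (h * b j)))) Z) = N Z.
Proof.
have unit_norm (x : R) :
    (1 +i* x) / (1 -i* x) * ((1 +i* x) / (1 -i* x))^*%R = 1 :> R[i].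
  have conjE (y z : R) : (y +i* z)^*%R = y -i* z by [].
  rewrite rmorphM/= fmorphV /= !conjE opprK mulf_div [X in _ / X]mulrC divff//.
  by rewrite mulf_neq0// eq_complex /= oner_eq0.
pose u := diag_mx (\row_i ((1 +i* (h * a i)) / (1 -i* (h * a i)))).
pose v := diag_mx (\row_j ((1 -i* (h * b j)) / (1 +i* (h * b j)))).
have diag_unitary (w : 'rV[R[i]]_n) : (forall i, w 0 i * (w 0 i)^*%R = 1) ->
    diag_mx w \is unitarymx.
  move=> w1; apply/unitarymxP/matrixP => i j; rewrite mul_diag_mx !mxE.
  rewrite eq_sym; case: eqP => [->|_]; last by rewrite mulr0n conjC0 mulr0.
  by rewrite mulr1n w1.
rewrite -(uinormU hN (U := u) (V := v) Z); first last.
- apply: diag_unitary => j; rewrite mxE.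
  by have := unit_norm (- (h * b j)); rewrite opprK.
- by apply: diag_unitary => j; rewrite mxE.
congr N; apply/matrixP => i j.
rewrite mul_mx_diag mul_diag_mx !mxE invfM; ring.
Qed.
End SchurMultiplier.

(** * Second-order error of the Cayley transform *)

Section CayleyError.
Context {R : realType}.

(** With d = a - b the difference is exactly 2ihd (-h^2 ab + ihd) / q, where |q| >= 1. Both
    numerator factors are O(h), the second because h^2 <= h. *)
Lemma cayley_error (a b h : R) : 0 < h <= 1 ->
  normc ((1 +i* (h * a)) * (1 -i* (h * b)) /
         ((1 -i* (h * a)) * (1 +i* (h * b))) - (1 +i* (2 * h * (a - b))))
  <= h ^+ 2 * (2 * `|a - b| * (`|a * b| + `|a - b|)).
Proof.
move=> /andP[h0 h1].
set q := (1 -i* (h * a)) * (1 +i* (h * b)).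
have qE : q = (1 + h ^+ 2 * (a * b)) +i* (- (h * (a - b))).
  by rewrite /q; simpc; congr (_ +i* _); ring.
have q0 : q != 0 by rewrite mulf_neq0// eq_complex /= oner_eq0.
(* Both factors of [q] have real part 1. *)
have q1 : 1 <= normc q.
  rewrite normcM -[leLHS]mulr1 ler_pM//.
    by apply: le_trans _ (ler_normc_Re _ _); rewrite normr1.
  by apply: le_trans _ (ler_normc_Re _ _); rewrite normr1.
have -> : (1 +i* (h * a)) * (1 -i* (h * b)) / q - (1 +i* (2 * h * (a - b))) =
    (0 +i* (2 * h * (a - b))) * ((- (h ^+ 2 * (a * b))) +i* (h * (a - b))) / q.
  apply: (mulIf q0); rewrite mulrBl !divfK// qE; simpc.
  by congr (_ +i* _); ring.
rewrite !normcM normcV normc_imag.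
have d2 : normc (- (h ^+ 2 * (a * b)) +i* (h * (a - b))) <=
    h * (`|a * b| + `|a - b|).
  apply: le_trans (normc_le_add _ _) _.
  rewrite normrN [leRHS]mulrDr; apply: lerD; last first.
    by rewrite normrM (ger0_norm (ltW h0)).
  rewrite normrM ger0_norm ?sqr_ge0// ler_wpM2r// expr2 ler_piMl// ltW//.
rewrite -[leRHS]mulr1 ler_pM//.
- by rewrite mulr_ge0// normc_ge0.
- by rewrite invr_ge0; apply: le_trans q1.
- have -> : h ^+ 2 * (2 * `|a - b| * (`|a * b| + `|a - b|)) =
    (2 * h * `|a - b|) * (h * (`|a * b| + `|a - b|)) by ring.
  rewrite ler_pM ?normc_ge0//.
  by rewrite normrM (ger0_norm (x := 2 * h)) ?mulr_ge0// ltW.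
- by rewrite invf_le1// (lt_le_trans _ q1).
Qed.

End CayleyError.

(** * Monotonicity in g of the norm under the multipliers 1 + igd *)

Section Dissipative.
Context {R : realType} {n : nat} (N : 'M[R[i]]_n -> R).
Context (hN : unitarily_invariant_norm N).
Implicit Types (a b : 'I_n -> R) (Z : 'M[R[i]]_n).

Lemma schur_1Di_conv a b Z (k : R) :
  schur (fun i j => 1 +i* (k * (a i - b j))) Z =
  (1 - k)%:C *: Z + k%:C *: schur (fun i j => 1 +i* (a i - b j)) Z.
Proof.
apply/matrixP => i j; rewrite !mxE mulrA -mulrDl; congr (_ * _); simpc.
by congr (_ +i* _); ring.
Qed.

(* Convexity of [h |-> N ((1 + ihd) Z)] reduces the claim to first order at
   [h = 0], where [1 + ihd] agrees with an isometry. *)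
Lemma uinorm_le_1Di a b Z :
  N Z <= N (schur (fun i j => 1 +i* (a i - b j)) Z).
Proof.
set G := N (schur _ Z).
(* The constants of [cayley_error] summed over all entries, independent of h. *)
pose K := \sum_i \sum_j 2 * `|a i - b j| * (`|a i * b j| + `|a i - b j|) *
           normc (Z i j) * N (delta_mx i j).
have K0 : 0 <= K.
  apply: sumr_ge0 => i _; apply: sumr_ge0 => j _.
  by rewrite !mulr_ge0 ?addr_ge0 ?normc_ge0 ?(uinorm_ge0 hN).
have step h : 0 < h -> 2 * h <= 1 -> N Z <= G + h / 2 * K.
  move=> h0 h1.
  have le1 : N Z <= N (schur (fun i j => 1 +i* (2 * h * (a i - b j))) Z) +
                 h ^+ 2 * K.
    rewrite -lerBlDl -[X in X - _](uinorm_cayley hN a b h Z).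
    apply: le_trans (ler_norm _) _; apply: le_trans (uinorm_distr hN _ _) _.
    apply: le_trans (uinorm_le_entries hN _) _.
    rewrite mulr_sumr; apply: ler_sum => i _.
    rewrite mulr_sumr; apply: ler_sum => j _.
    rewrite !mxE -mulrBl normcM 2!mulrA ler_wpM2r ?(uinorm_ge0 hN)//.
    rewrite mulrA ler_wpM2r ?normc_ge0//.
    rewrite -(mulrA (h ^+ 2)); apply: cayley_error; rewrite h0; lra.
  (* Convexity at parameter 2h: the term (1 - 2h) N Z is absorbed by the left-hand side, and
     dividing by 2h leaves an error linear in h. *)
  have le2 := uinormD hN ((1 - 2 * h)%:C *: Z)
    ((2 * h)%:C *: schur (fun i j => 1 +i* (a i - b j)) Z).
  move: le2; rewrite -schur_1Di_conv !(uinorm_realZ hN); [|lra|lra].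
  rewrite -/G => le2.
  have : 2 * h * N Z <= 2 * h * (G + h / 2 * K).
    have -> : 2 * h * (G + h / 2 * K) = 2 * h * G + h ^+ 2 * K by field.
    lra.
  by rewrite ler_pM2l//; lra.
apply/ler_addgt0Pr => e e0.
(* This h satisfies 2h <= 1 and makes the error hK/2 at most e/4; the denominator stays positive
   even if K = 0. *)
have h0 : 0 < e / (e + K) / 2 by rewrite !divr_gt0// ltr_pwDl.
have eK : e / (e + K) <= 1 by rewrite ler_pdivrMr ?ltr_pwDl// mul1r lerDl.
apply: le_trans (step _ h0 _) _; first by lra.
rewrite lerD2l.
have -> : e / (e + K) / 2 / 2 * K = e * (K / (e + K)) / 4.
  by field; rewrite gt_eqF// ltr_pwDl.
have : K / (e + K) <= 1 by rewrite ler_pdivrMr ?ltr_pwDl// mul1r lerDr ltW.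
by move=> /(ler_wpM2l (ltW e0)); lra.
Qed.

(** The multiplier 1 + igd is a convex combination of 1 and 1 + id, and [uinorm_le_1Di] bounds the
    contribution of 1. *)
Lemma uinorm_1Di_homo a b (g : R) Z : 0 <= g <= 1 ->
  N (schur (fun i j => 1 +i* (g * (a i - b j))) Z) <=
  N (schur (fun i j => 1 +i* (a i - b j)) Z).
Proof.
move=> /andP[g0 g1]; rewrite schur_1Di_conv.
apply: le_trans (uinormD hN _ _) _; rewrite !(uinorm_realZ hN) ?subr_ge0//.
have := uinorm_le_1Di a b Z; move: (N _) (N _) => x y xy.
by have := ler_wpM2l (_ : 0 <= 1 - g) xy; rewrite subr_ge0 => /(_ g1); lra.
Qed.

(** Schur multipliers commute, so factors are rescaled one at a time: the tail by induction, the
    head by [uinorm_1Di_homo] with [a] and [b] multiplied by [c]. *)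
Lemma uinorm_prod_1Di_homo a b (g : R) (cs : seq R) Z : 0 <= g <= 1 ->
  N (schur (fun i j => \prod_(c <- cs) (1 +i* (c * (g * (a i - b j))))) Z) <=
  N (schur (fun i j => \prod_(c <- cs) (1 +i* (c * (a i - b j)))) Z).
Proof.
move=> g01; elim: cs Z => [|c cs ih] Z.
  by rewrite !schur1// => i j; rewrite big_nil.
pose F (g : R) Z :=
  schur (fun i j => \prod_(c <- cs) (1 +i* (c * (g * (a i - b j))))) Z.
pose f (g : R) i j : R[i] := 1 +i* (g * (c * a i - c * b j)).
have -> :
    schur (fun i j => \prod_(c <- c :: cs) (1 +i* (c * (g * (a i - b j))))) Z
    = schur (f g) (F g Z).
  by rewrite schurA; apply: eq_schur => i j; rewrite big_cons /f -mulrBr mulrCA.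
have -> : schur (fun i j => \prod_(c <- c :: cs) (1 +i* (c * (a i - b j)))) Z
    = schur (fun i j => \prod_(c <- cs) (1 +i* (c * (a i - b j))))
        (schur (f 1) Z).
  rewrite schurA; apply: eq_schur => i j.
  by rewrite big_cons /f -mulrBr mul1r mulrC.
apply: le_trans (ih _).
rewrite -/(F g _) [leRHS](_ : _ = N (schur (f 1) (F g Z))).
  apply: le_trans (uinorm_1Di_homo _ _ _ g01) _.
  rewrite le_eqVlt; apply/orP; left; apply/eqP; congr N.
  by apply: eq_schur => i j; rewrite /f mul1r.
by rewrite /F schurC.
Qed.

End Dissipative.

(** * The function sinh x / x and its polynomial approximants *)

Section Sinhc.
Context {R : realType}.
Implicit Types (x y : R).

Definition sinhc x : R := if x == 0 then 1 else (expR x - expR (- x)) / (2 * x).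

(** For x nonzero and m = n + 1 this is ((1 + x/m)^m - (1 - x/m)^m) / (2x); the geometric sum makes
    it visibly a polynomial, defined at 0 as well. *)
Definition sinhc_approx (n : nat) x : R :=
  n.+1%:R^-1 *
  \sum_(i < n.+1) (1 + x / n.+1%:R) ^+ (n - i) * (1 - x / n.+1%:R) ^+ i.

(** Because |1 + z|^2 - |1 - z|^2 = 4 Re z. *)
Lemma normc_eq_imag (z : R[i]) :
  normc (1 + z) = normc (1 - z) -> complex.Re z = 0.
Proof.
case: z => a b /= /(congr1 (fun x => x ^+ 2)).
rewrite !sqr_sqrtr ?addr_ge0 ?sqr_ge0// => e; lra.
Qed.

(* The roots of [((1 + z)^(n+1) - (1 - z)^(n+1)) / (2 z)] satisfy
   [|1 + z| = |1 - z|], hence are purely imaginary. *)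
Lemma sinhc_approx_prod (n : nat) : exists cs : seq R,
  forall x, (sinhc_approx n x)%:C = \prod_(c <- cs) (1 +i* (c * x)).
Proof.
pose q : {poly R[i]} := \sum_(i < n.+1) (1 + 'X) ^+ (n - i) * (1 - 'X) ^+ i.
have qE (z : R[i]) : q.[z] = \sum_(i < n.+1) (1 + z) ^+ (n - i) * (1 - z) ^+ i.
  by rewrite horner_sum; apply: eq_bigr => i _; rewrite !hornerE.
have q0 : q.[0] = n.+1%:R.
  rewrite qE; under eq_bigr do rewrite addr0 subr0 !expr1n mulr1.
  by rewrite sumr_const card_ord.
have [rs] := closed_field_poly_normal q; set lc := lead_coef q => qrs.
have n0 : n.+1%:R != 0 :> R[i] by rewrite pnatr_eq0.
have root_imag z : z \in rs -> exists2 b : R, z = 0 +i* b & b != 0.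
  move=> zrs; have qz : q.[z] = 0.
    rewrite qrs hornerZ; apply/eqP.
    by rewrite mulf_eq0 -[X in _ || X]/(root _ z) root_prod_XsubC zrs orbT.
  (* The value n + 1 of [q] at 0 excludes the root 0, so the roots can be inverted. *)
  have z0 : z != 0.
    by move: n0; apply: contra_neq => z0; rewrite -q0 -[RHS]qz z0.
  have : (1 + z) ^+ n.+1 = (1 - z) ^+ n.+1.
    by apply/eqP; rewrite -subr_eq0 subrXX /= -qE qz mulr0.
  move=> /(congr1 (@ComplexField.Normc.normc R)).
  have normcX (w : R[i]) k : normc (w ^+ k) = normc w ^+ k.
    elim: k => [|k ih]; first by rewrite !expr0 ComplexField.Normc.normc1.
    by rewrite !exprS normcM ih.
  rewrite !normcX => /pexpIrn -/(_ isT); rewrite !nnegrE !normc_ge0.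
  move=> /(_ isT isT) /normc_eq_imag.
  move: z0; case: z {zrs qz} => a b /= z0 a0; exists b; first by rewrite a0.
  by move: z0; apply: contra_neq => ->; rewrite a0.
(* For a root z = ib and m = n + 1, x/m - z = -z (1 + i x/(mb)), whence c = 1/(mb). The factors -z
   and the leading coefficient multiply to q(0) = m. *)
exists [seq (complex.Im z * n.+1%:R)^-1 | z <- rs] => x.
have lcE : lc * \prod_(z <- rs) - z = n.+1%:R.
  rewrite -q0 [in RHS]qrs hornerZ horner_prod; congr (_ * _).
  by apply: eq_bigr => z _; rewrite !hornerE.
have -> : (sinhc_approx n x)%:C = n.+1%:R^-1 * q.[(x / n.+1%:R)%:C].
  rewrite qE /sinhc_approx rmorphM /= fmorphV /= rmorph_nat; congr (_ * _).
  rewrite rmorph_sum; apply: eq_bigr => i _.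
  by rewrite rmorphM !rmorphXn /= rmorphD rmorphB /= rmorph1.
apply: (mulfI n0); rewrite mulVKf// -[in RHS]lcE qrs hornerZ -mulrA.
congr (_ * _); rewrite big_map horner_prod -big_split; apply: eq_big_seq => z.
move=> /root_imag[b -> b0]; rewrite !hornerE /=; simpc.
by congr (_ +i* _); field; rewrite b0 nat1r pnatr_eq0.
Qed.

(** Squeeze with m = n + 1 and y = x/m. The upper bound is 1 + y <= e^y. For the lower bound (1 -
    x^2/m) e^x, Bernoulli's inequality is applied to (1 - y^2)^m = (1 - y)^m (1 + y)^m, and (1 -
    y)^m <= e^(-x). *)
Lemma expR_cvg x : (1 + x / n.+1%:R) ^+ n.+1 @[n --> \oo] --> expR x.
Proof.
have pos n : 0 < n.+1%:R :> R by rewrite ltr0n.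
have inv0 : x ^+ 2 / n.+1%:R @[n --> \oo] --> (0 : R).
  by rewrite -(mulr0 (x ^+ 2)); apply: cvgMr; exact: cvg_harmonic.
apply: (@squeeze_cvgr _ _ _ _ (fun n => (1 - x ^+ 2 / n.+1%:R) * expR x)
  (fun=> expR x)); first last.
- exact: cvg_cst.
- have : (1 - x ^+ 2 / n.+1%:R) * expR x @[n --> \oo] --> (1 - 0) * expR x.
    by apply: cvgMl; apply: cvgB => //; exact: cvg_cst.
  by rewrite subr0 mul1r.
(* Eventually |x| <= n + 1, so that 1 + y and 1 - y are nonnegative. *)
near=> n.
have xn : `|x| <= n.+1%:R.
  near: n; exists (Num.truncn `|x|) => // n /= hn.
  apply: le_trans (ltW (truncnS_gt _)) _.
  by rewrite ler_nat ltnS.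
set y := x / n.+1%:R.
have y1 : `|y| <= 1.
  by rewrite normrM normfV (gtr0_norm (pos n)) ler_pdivrMr// mul1r.
move: (y1); rewrite ler_norml => /andP[yl yu].
have expE (z : R) : expR (z / n.+1%:R) ^+ n.+1 = expR z.
  by rewrite -expRM_natr divfK// gt_eqF.
have ub (z : R) : 0 <= 1 + z / n.+1%:R -> (1 + z / n.+1%:R) ^+ n.+1 <= expR z.
  by move=> z0; rewrite -[leRHS]expE lerXn2r ?nnegrE ?expR_ge0// expR_ge1Dx.
apply/andP; split; last by apply: ub; rewrite -/y; lra.
have bern (k : nat) (z : R) : 0 <= z <= 1 -> 1 - k%:R * z <= (1 - z) ^+ k.
  move=> /andP[z0 z1]; elim: k => [|k ih]; first by rewrite mul0r subr0.
  rewrite exprS; apply: le_trans (ler_wpM2l _ ih); last by lra.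
  have : 0 <= k%:R * z * z by rewrite !mulr_ge0.
  by rewrite -natr1; nra.
have h1 : 1 - x ^+ 2 / n.+1%:R <= (1 - y ^+ 2) ^+ n.+1.
  have -> : x ^+ 2 / n.+1%:R = n.+1%:R * y ^+ 2.
    by rewrite /y; field; rewrite gt_eqF.
  by apply: bern; rewrite sqr_ge0 -real_normK ?num_real// expr_le1.
apply: le_trans (ler_wpM2r (expR_ge0 _) h1) _.
have -> : 1 - y ^+ 2 = (1 - y) * (1 + y) by ring.
rewrite exprMn mulrAC -[leRHS]mul1r ler_wpM2r//.
  by rewrite exprn_ge0//; lra.
rewrite -[leRHS](expRxMexpNx_1 x) mulrC ler_wpM2l ?expR_ge0//.
by have := ub (- x); rewrite mulNr; apply; rewrite -/y; lra.
Unshelve. all: by end_near.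
Qed.

Lemma sinhc_approx_cvg x : sinhc_approx n x @[n --> \oo] --> sinhc x.
Proof.
have n0 n : n.+1%:R != 0 :> R by rewrite pnatr_eq0.
rewrite /sinhc; have [->|x0] := eqVneq x 0.
  rewrite (_ : (fun n => _) = fun=> 1); first exact: cvg_cst.
  apply/funext => n; rewrite /sinhc_approx mul0r addr0 subr0.
  under eq_bigr do rewrite !expr1n mulr1.
  by rewrite sumr_const card_ord mulVf.
rewrite (_ : (fun n => _) = fun n =>
  ((1 + x / n.+1%:R) ^+ n.+1 - (1 + (- x) / n.+1%:R) ^+ n.+1) / (2 * x)).
  by apply: cvgMl; apply: cvgB; exact: expR_cvg.
apply/funext => n; rewrite mulNr subrXX /sinhc_approx /=.
by move: (\sum_(_ < _) _) => S; field; rewrite x0 nat1r n0.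
Qed.


End Sinhc.

(** * Monotonicity in u of the norm under the multipliers [sinhc] of ud *)

Section SinhcNorm.
Context {R : realType} {n : nat} (N : 'M[R[i]]_n -> R).
Context (hN : unitarily_invariant_norm N).
Implicit Types (a b : 'I_n -> R) (Z : 'M[R[i]]_n).

Lemma sinhc0 : sinhc 0 = 1 :> R.
Proof. by rewrite /sinhc eqxx. Qed.

Lemma mulr_sinhc (x : R) : 2 * x * sinhc x = expR x - expR (- x).
Proof.
rewrite /sinhc; case: eqVneq => [->|x0]; first by rewrite oppr0; ring.
by field.
Qed.

Lemma uinorm_sinhc_homo a b (g : R) Z : 0 <= g <= 1 ->
  N (schur (fun i j => (sinhc (g * (a i - b j)))%:C) Z) <=
  N (schur (fun i j => (sinhc (a i - b j))%:C) Z).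
Proof.
move=> g01.
have cvgS (d : 'I_n -> 'I_n -> R) :
    N (schur (fun i j => (sinhc_approx k (d i j))%:C) Z) @[k --> \oo]
    --> N (schur (fun i j => (sinhc (d i j))%:C) Z).
  pose f k i j := sinhc_approx k (d i j).
  apply: (uinorm_schur_cvg hN (f := f)) => i j.
  exact: sinhc_approx_cvg.
apply: (ler_cvg_to (cvgS (fun i j => g * (a i - b j)))
                   (cvgS (fun i j => a i - b j))).
apply: nearW => k; have [cs csE] := sinhc_approx_prod (R := R) k.
rewrite (eq_schur _ (fun i j => csE (g * (a i - b j)))).
rewrite (eq_schur _ (fun i j => csE (a i - b j))).
exact: uinorm_prod_1Di_homo.
Qed.

(** Multiplying [a] and [b] by v reduces this to g = u/v; the case v = 0 forces u = 0. *)
Lemma uinorm_sinhc_le a b (u v : R) Z : 0 <= u <= v ->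
  N (schur (fun i j => (sinhc (u * (a i - b j)))%:C) Z) <=
  N (schur (fun i j => (sinhc (v * (a i - b j)))%:C) Z).
Proof.
move=> /andP[u0 uv]; have [v0|v0] := eqVneq v 0.
  by have -> : u = v by lra.
have vp : 0 < v by rewrite lt_neqAle eq_sym v0; lra.
have g01 : 0 <= u / v <= 1.
  by rewrite divr_ge0 ?(ltW vp)//= ler_pdivrMr// mul1r.
have := uinorm_sinhc_homo (fun i => v * a i) (fun j => v * b j) Z g01.
congr (N _ <= N _); apply: eq_schur => i j; congr (sinhc _)%:C.
  by rewrite -mulrBr mulrA divfK.
by rewrite mulrBr.
Qed.

(* [x cosh(bx) / sinh(ax) = sinhc(2bx) / (a sinhc(bx) sinhc(ax))]. *)
Lemma uinorm_cosh_le a b (al be : R) Z : 0 <= be -> 2 * be <= al ->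
  N (schur (fun i j =>
    ((expR (be * (a i - b j)) + expR (- (be * (a i - b j)))) / 2)%:C) Z) <=
  N (schur (fun i j => (sinhc (al * (a i - b j)))%:C) Z).
Proof.
move=> b0 ba.
have coshE (x : R) : (expR x + expR (- x)) / 2 * sinhc x = sinhc (2 * x).
  have [->|x0] := eqVneq x 0; first by rewrite mulr0 oppr0 expR0 sinhc0; field.
  rewrite /sinhc mulf_eq0 (negPf x0) orbF pnatr_eq0 /=.
  have expR2 (y : R) : expR (2 * y) = expR y * expR y.
    by rewrite -expRD; congr expR; ring.
  by rewrite -mulrN !expR2; field.
apply: le_trans (uinorm_sinhc_le a b _ (u := 2 * be) _); last by lra.
set W := schur _ Z.
(* As [sinhc] is 1 at 0, multiplying W by [sinhc] of be d does not decrease its norm, and by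
   duplication it turns the cosh multiplier into [sinhc] of 2 be d. *)
have := uinorm_sinhc_le a b W (u := 0) (v := be); rewrite lexx b0 => /(_ isT).
rewrite schur1; last by move=> i j; rewrite mul0r sinhc0.
move=> /le_trans; apply.
rewrite schurA le_eqVlt; apply/orP; left; apply/eqP; congr N.
by apply: eq_schur => i j; rewrite -rmorphM mulrC coshE mulrA.
Qed.
End SinhcNorm.

(** * Scalar integrals over a segment *)

Section Integral.
Context {R : realType}.
Local Notation mu := (@lebesgue_measure R).

Lemma continuous_integrable_itv (f : R -> R) (a b : R) : continuous f ->
  mu.-integrable `[a, b] (EFin \o f).
Proof.
move=> cf; apply: continuous_compact_integrable; first exact: segment_compact.
exact: continuous_subspaceT.
Qed.

(** Endpoints must be ignored: when s = 0 the exponents reach 0 and 1, where the convention 0^0 = 1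
    breaks the exponential formula for the integrand. *)
Lemma Rintegral_eq_itv_oo (f g : R -> R) (a b : R) : continuous g ->
  (forall x, a < x < b -> f x = g x) ->
  \int[mu]_(x in `[a, b]) f x = \int[mu]_(x in `[a, b]) g x.
Proof.
move=> cg fg; rewrite /Rintegral; congr fine.
have mg : measurable_fun `]a, b[ g.
  by apply: measurable_funTS; exact: continuous_measurable_fun.
have fg' x : x \in `]a, b[%R -> f x = g x by rewrite in_itv; exact: fg.
apply: eq_integral_itv_bounded => //.
by apply: eq_measurable_fun mg => x; rewrite inE => /fg'.
Qed.

Lemma Rintegral_sum (I : Type) (r : seq I) (f : I -> R -> R) (a b : R) :
  (forall i, continuous (f i)) ->
  \int[mu]_(x in `[a, b]) (\sum_(i <- r) f i x) =
  \sum_(i <- r) \int[mu]_(x in `[a, b]) f i x.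
Proof.
move=> cf; elim: r => [|i r ih].
  rewrite big_nil; under eq_Rintegral do rewrite big_nil.
  by rewrite Rintegral_cst// mul0r.
rewrite big_cons -ih; under eq_Rintegral do rewrite big_cons.
rewrite RintegralD//; apply: continuous_integrable_itv => //.
by move=> x; apply: cvg_big => [|j _]; [exact: add_continuous|exact: cf].
Qed.

(** Writing the endpoints as midpoint plus or minus half-length makes sinh appear; [sinhc] also
    covers d = 0. *)
Lemma Rintegral_expR (c d a b : R) : a <= b ->
  \int[mu]_(x in `[a, b]) expR (d * x + c) =
  (b - a) * expR (d * ((a + b) / 2) + c) * sinhc (d * ((b - a) / 2)).
Proof.
move=> ab.
have [->|d0] := eqVneq d 0.
  under eq_Rintegral do rewrite mul0r.
  rewrite !mul0r sinhc0 mulr1 Rintegral_cst//= mulrC.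
  rewrite lebesgue_measure_itv /= lte_fin; congr (_ * _).
  by case: ltgtP ab => //= -> _; rewrite subrr.
have [->|anb] := eqVneq a b.
  by rewrite set_itv1 Rintegral_set1 subrr !mul0r.
have {}ab : a < b by rewrite lt_neqAle anb.
pose F (x : R) := expR (d * x + c) / d.
have dF (x : R) : is_derive x 1 F (expR (d * x + c)).
  rewrite /F; apply: is_derive_eq.
  by rewrite /GRing.scale /=; field.
have cF : continuous F.
  by move=> x; apply: differentiable_continuous; apply/derivable1_diffP;
    case: (dF x).
have cf : continuous (fun x => expR (d * x + c)).
  move=> x; apply: continuous_comp; last exact: continuous_expR.
  by apply: cvgD; [apply: cvgMr; exact: cvg_id | exact: cvg_cst].
rewrite /Rintegral (@continuous_FTC2 _ _ F)//=.
- have e1 (x y : R) :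
      expR (x + y) - expR (x - y) = expR x * (2 * y * sinhc y).
    by rewrite mulr_sinhc !expRD; ring.
  have -> : F b - F a = (expR (d * b + c) - expR (d * a + c)) / d.
    by rewrite /F mulrBl.
  have -> : d * b + c = (d * ((a + b) / 2) + c) + d * ((b - a) / 2) by field.
  have -> : d * a + c = (d * ((a + b) / 2) + c) - d * ((b - a) / 2) by field.
  by rewrite e1; field.
- exact: continuous_subspaceT.
- split.
  + by move=> x _; case: (dF x).
  + exact: cvg_at_right_filter (cF a).
  + exact: cvg_at_left_filter (cF b).
- by move=> x _; rewrite derive1E derive_val.
Qed.

End Integral.

(** * Entrywise integrals of Schur multipliers *)

Section MatrixIntegral.
Context {R : realType} {n : nat}.
Local Notation mu := (@lebesgue_measure R).

Lemma Re_mulr_real (z : R[i]) (x : R) :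
  complex.Re (z * x%:C) = complex.Re z * x.
Proof. by case: z => a b /=; rewrite mulr0 subr0. Qed.

Lemma Im_mulr_real (z : R[i]) (x : R) :
  complex.Im (z * x%:C) = complex.Im z * x.
Proof. by case: z => a b /=; rewrite mulr0 add0r. Qed.

Lemma Re_sum (I : Type) (r : seq I) (f : I -> R[i]) :
  complex.Re (\sum_(i <- r) f i) = \sum_(i <- r) complex.Re (f i).
Proof. by apply: big_morph => // -[a b] [c d]. Qed.

Lemma Im_sum (I : Type) (r : seq I) (f : I -> R[i]) :
  complex.Im (\sum_(i <- r) f i) = \sum_(i <- r) complex.Im (f i).
Proof. by apply: big_morph => // -[a b] [c d]. Qed.

Lemma mulmx_schur_coord (P Q Y : 'M[R[i]]_n) (f : 'I_n -> 'I_n -> R) i j :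
  (P *m schur (fun k l => (f k l)%:C) Y *m Q) i j =
  \sum_(p : 'I_n * 'I_n) (P i p.1 * Y p.1 p.2 * Q p.2 j) * (f p.1 p.2)%:C.
Proof.
rewrite -(pair_bigA _ (fun k l => (P i k * Y k l * Q l j) * (f k l)%:C)) /=.
rewrite exchange_big mxE; apply: eq_bigr => l _.
rewrite mxE mulr_suml; apply: eq_bigr => k _.
by rewrite mxE; ring.
Qed.

(** Each entry is a finite linear combination of multiplier values. [psi] is a continuous version of
    [phi], from which [phi] may differ at the endpoints. *)
Lemma mxintegral_schur (P Q Y : 'M[R[i]]_n) (phi : R -> 'I_n -> 'I_n -> R)
    (psi : 'I_n -> 'I_n -> R -> R) (a b : R) :
  (forall k l, continuous (psi k l)) ->
  (forall v k l, a < v < b -> phi v k l = psi k l v) ->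
  mxintegral `[a, b] (fun v => P *m schur (fun k l => (phi v k l)%:C) Y *m Q) =
  P *m schur (fun k l => (\int[mu]_(v in `[a, b]) psi k l v)%:C) Y *m Q.
Proof.
move=> cpsi phipsi; apply/matrixP => i j; rewrite mxE.
set c := fun p : 'I_n * 'I_n => P i p.1 * Y p.1 p.2 * Q p.2 j.
(* The multipliers are real, so one real-linear identity serves both real and imaginary parts. *)
have int_lin (h : 'I_n * 'I_n -> R) :
    \int[mu]_(v in `[a, b]) (\sum_p h p * phi v p.1 p.2) =
    \sum_p h p * \int[mu]_(v in `[a, b]) psi p.1 p.2 v.
  have cont p : continuous (fun v => h p * psi p.1 p.2 v).
    by move=> v; apply: cvgMr; exact: cpsi.
  rewrite (@Rintegral_eq_itv_oo _ _ (fun v => \sum_p h p * psi p.1 p.2 v)).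
  - rewrite Rintegral_sum//; apply: eq_bigr => p _.
    by rewrite RintegralZl//; exact: continuous_integrable_itv.
  - by move=> v; apply: cvg_big => [|p _]; [exact: add_continuous|exact: cont].
  - by move=> v avb; apply: eq_bigr => p _; rewrite phipsi.
have ReE v : complex.Re ((P *m schur (fun k l => (phi v k l)%:C) Y *m Q) i j) =
    \sum_p complex.Re (c p) * phi v p.1 p.2.
  rewrite mulmx_schur_coord Re_sum; apply: eq_bigr => p _.
  by rewrite Re_mulr_real.
have ImE v : complex.Im ((P *m schur (fun k l => (phi v k l)%:C) Y *m Q) i j) =
    \sum_p complex.Im (c p) * phi v p.1 p.2.
  rewrite mulmx_schur_coord Im_sum; apply: eq_bigr => p _.
  by rewrite Im_mulr_real.
under eq_Rintegral do rewrite ReE.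
under [X in _ +i* X]eq_Rintegral do rewrite ImE.
rewrite !int_lin mulmx_schur_coord [RHS]complexE.
rewrite Re_sum Im_sum.
under [in RHS]eq_bigr do rewrite Re_mulr_real.
under [X in _ = _ + _ * X%:C]eq_bigr do rewrite Im_mulr_real.
by rewrite mulrC; simpc.
Qed.

End MatrixIntegral.

(** * Matrix powers in the eigenbases *)

Section Heinz.
Context {R : realType} {n : nat}.
Implicit Types A B X : 'M[R[i]]_n.

Lemma invmx_unitarymx (P : 'M[R[i]]_n) :
  P \is unitarymx -> invmx P \is unitarymx.
Proof. by move=> uP; rewrite (invmx_unitary uP) trmxC_unitary. Qed.

Lemma mulmx_diag_schur (P P' Q Q' X : 'M[R[i]]_n) (c d : 'rV[R[i]]_n) :
  (P' *m diag_mx c *m P) *m X *m (Q' *m diag_mx d *m Q) =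
  P' *m schur (fun k l => c 0 k * d 0 l) (P *m X *m Q') *m Q.
Proof.
have -> : schur (fun k l => c 0 k * d 0 l) (P *m X *m Q') =
    diag_mx c *m (P *m X *m Q') *m diag_mx d.
  move: (P *m X *m Q') => Y; apply/matrixP => k l.
  by rewrite mul_mx_diag mul_diag_mx !mxE mulrAC.
by rewrite !mulmxA.
Qed.

Lemma mxpowR_mulmx A B X (r r' : R) :
  mxpowR A r *m X *m mxpowR B r' =
  invmx (spectralmx A) *m
  schur (fun k l => (complex.Re (spectral_diag A 0 k) `^ r *
                     complex.Re (spectral_diag B 0 l) `^ r')%:C)
    (spectralmx A *m X *m invmx (spectralmx B)) *m spectralmx B.
Proof.
rewrite /mxpowR mulmx_diag_schur.
set Y := spectralmx A *m X *m invmx (spectralmx B); move: Y => Y.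
move: (invmx _) (spectralmx B) => P Q.
apply: (congr1 (fun Z => P *m Z *m Q)); apply: eq_schur => k l.
by rewrite !mxE rmorphM.
Qed.

(** Nonzero powers of 0 vanish; the indicators record this and make the default value of [ln] at 0
    harmless. *)
Lemma powR_mul_heinz (x y v : R) : v != 0 -> 1 - v != 0 ->
  x `^ v * y `^ (1 - v) =
  (x != 0)%:R * (y != 0)%:R * expR ((ln x - ln y) * v + ln y).
Proof.
move=> v0 v1; rewrite /powR (negPf v0) (negPf v1).
case: eqVneq => _ /=; first by rewrite !mul0r.
case: eqVneq => _ /=; first by rewrite !(mulr0, mul0r).
by rewrite !mul1r -expRD; congr expR; ring.
Qed.

End Heinz.

Theorem theorem2p3 (R : realType) (n : nat) (A B X : 'M[R[i]]_n) (s t : R)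
    (hA : psdmx A) (hB : psdmx B)
    (hs0 : 0 <= s) (hs : s < 1 / 2) (ht : `|1 - 2 * t| < (1 - 2 * s) / 2)
    (N : 'M[R[i]]_n -> R) (hN : unitarily_invariant_norm N) :
  N (mxpowR A (1 - t) *m X *m mxpowR B t
     + mxpowR A t *m X *m mxpowR B (1 - t))
  <= 2 / (1 - 2 * s)
     * N (mxintegral `[s, 1 - s] (fun v => mxpowR A v *m X *m mxpowR B (1 - v))).
Proof.
set P := spectralmx A; set Q := spectralmx B; set Y := P *m X *m invmx Q.
pose la k := complex.Re (spectral_diag A 0 k).
pose mu l := complex.Re (spectral_diag B 0 l).
pose a k := ln (la k); pose b l := ln (mu l).
pose e k l : R := (la k != 0)%:R * (mu l != 0)%:R.
(* The integrand at the midpoint v = 1/2, that is A^(1/2) X B^(1/2) in the eigenbases: the common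
   factor of both sides. *)
pose Z := schur (fun k l => (e k l * expR ((a k - b l) / 2 + b l))%:C) Y.
(* [al] is the half-length of the interval and [be] the distance from t to 1/2; [ht] says 2 be <
   al. *)
pose al := 1 / 2 - s; pose be := `|1 - 2 * t| / 2.
have unitN W : N (invmx P *m W *m Q) = N W.
  by apply: (uinormU hN); rewrite ?invmx_unitarymx ?spectral_unitarymx.
have intE :
    mxintegral `[s, 1 - s] (fun v => mxpowR A v *m X *m mxpowR B (1 - v)) =
    invmx P *m ((1 - 2 * s)%:C *:
        schur (fun k l => (sinhc (al * (a k - b l)))%:C) Z) *m Q.
  rewrite (_ : (fun v => _) = fun v =>
    invmx P *m schur (fun k l => (la k `^ v * mu l `^ (1 - v))%:C) Y
      *m Q); last first.
    by apply/funext => v; rewrite mxpowR_mulmx.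
  rewrite (@mxintegral_schur R n _ _ _ _ (fun k l v =>
    e k l * expR ((a k - b l) * v + b l))); first last.
  (* Since s >= 0, interior points satisfy 0 < v < 1. *)
  - by move=> v k l /andP[sv vs]; apply: powR_mul_heinz; apply/eqP; lra.
  - move=> k l v; apply: cvgMr.
    apply: continuous_comp; last exact: continuous_expR.
    by apply: cvgD; [apply: cvgMr; exact: cvg_id | exact: cvg_cst].
  apply: (congr1 (fun W => invmx P *m W *m Q)); apply/matrixP => k l.
  rewrite !mxE RintegralZl//; last first.
    apply: continuous_integrable_itv => v.
    apply: continuous_comp; last exact: continuous_expR.
    by apply: cvgD; [apply: cvgMr; exact: cvg_id | exact: cvg_cst].
  rewrite Rintegral_expR; last by lra.
  rewrite !mulrA -!rmorphM /=; congr (_%:C * _).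
  have -> : (a k - b l) * (s + (1 - s)) / 2 = (a k - b l) / 2 by field.
  have -> : (a k - b l) * (1 - s - s) / 2 = al * (a k - b l).
    by rewrite /al; field.
  by ring.
have lhsE : mxpowR A (1 - t) *m X *m mxpowR B t
     + mxpowR A t *m X *m mxpowR B (1 - t) =
    invmx P *m (2%:C *: schur (fun k l => ((expR (be * (a k - b l)) +
      expR (- (be * (a k - b l)))) / 2)%:C) Z) *m Q.
  (* With s >= 0 this gives |1 - 2t| < 1/2, so t and 1 - t are nonzero. *)
  move: ht; rewrite ltr_norml => /andP[t1 t2].
  apply: etrans (f_equal2 +%R (mxpowR_mulmx A B X (1 - t) t)
                              (mxpowR_mulmx A B X t (1 - t))) _.
  rewrite -mulmxDl -mulmxDr.
  apply: (congr1 (fun W => invmx P *m W *m Q)); apply/matrixP => k l.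
  rewrite !mxE -mulrDl -rmorphD /=.
  have heinz v : v != 0 -> 1 - v != 0 -> la k `^ v * mu l `^ (1 - v) =
    e k l * expR ((a k - b l) * v + b l) by exact: powR_mul_heinz.
  have := heinz (1 - t); rewrite subKr => ->; [|by apply/eqP; lra..].
  rewrite heinz; [|by apply/eqP; lra..].
  rewrite !mulrA -!rmorphM /=; congr (_%:C * _).
  (* The exponents t and 1 - t are symmetric about 1/2; the sign of 1 - 2t only swaps the two
     terms. *)
  have heinz_sum : expR ((a k - b l) * (1 - t) + b l) +
      expR ((a k - b l) * t + b l) =
      (expR (be * (a k - b l)) + expR (- (be * (a k - b l)))) *
      expR ((a k - b l) / 2 + b l).
    rewrite [RHS]mulrDl -!expRD /be; have [t0|t0] := leP 0 (1 - 2 * t).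
      by rewrite ger0_norm//; congr (expR _ + expR _); field.
    by rewrite ltr0_norm// addrC; congr (expR _ + expR _); field.
  by rewrite -mulrDr heinz_sum; field.
rewrite [leLHS](etrans (congr1 N lhsE) (unitN _)).
rewrite [X in _ <= _ * X](etrans (congr1 N intE) (unitN _)).
rewrite [leLHS](uinorm_realZ hN); last exact: ler0n.
rewrite [X in _ <= _ * X](uinorm_realZ hN); last by lra.
(* The interval length 1 - 2s cancels the denominator, leaving the factor 2 on both sides. *)
rewrite mulrA divfK; last by apply/eqP; lra.
rewrite ler_wpM2l//; apply: (uinorm_cosh_le hN).
  by rewrite divr_ge0.
by rewrite /be /al; lra.
Qed.
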